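(* For every integer $n>0$ and all complex $x,y,a,b$ with positive real parts (such that all denominators occurring below are non-zero) the following identities hold: $$\sum_{j=0}^{n}(-1)^{n-j}\binom nj (x+y+n-1)^{(n-j)}(x+n-j)^{(j)}(2y+n-j)^{(j)}(y)^{(n-j)}=(x-y)^{(n)}(y)^{(n)},$$ $$\sum_{j=0}^{n}(-1)^{j}\binom nj (2y+n-1)^{(j)}(y+j)^{(n-j)}(x)^{(j)}(x+y+j)^{(n-j)}=(y-x)^{(n)}(y)^{(n)},$$ $$\sum_{j=0}^{n}\binom nj\frac{(2b+n-1)^{(j)}(b-a)^{(n-j)}(a-b)^{(j)}(a+b+2j-1)}{(a+b+j-1)^{(n+1)}(2b)^{(j)}}=0,$$ $$\sum_{j=0}^{n}\binom nj\frac{(a+b+n-1)^{(j)}(a-b)^{(n-j)}(b-a)^{(j)}(2b+2j-1)}{(2b+j-1)^{(n+1)}(a+b)^{(j)}}=0,$$ $$\sum_{j=0}^{2n}(-1)^j\binom{2n}{j}(x+j)^{(2n-j)}(2x+2n-1)^{(j)}(y)^{(j)}(2y+j)^{(2n-j)}=\frac{(2n)!}{n!}(x-y)^{(n)}(y)^{(n)}(x+n)^{(n)},$$ $$\sum_{j=0}^{2n+1}(-1)^j\binom{2n+1}{j}(2x+2n)^{(j)}(x+j)^{(2n+1-j)}(y)^{(j)}(2y+j)^{(2n+1-j)}=0,$$ $$\sum_{j=0}^{n}\binom nj\frac{(x-y)^{(n-j)}(y-x)^{(j)}(x+y+n-1)^{(j)}}{(x+y)^{(j)}(2y+j-1)^{(j)}(2y+2j)^{(n-j)}}=0,$$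 $$\sum_{j=0}^{n}\binom nj\frac{(y-x)^{(j)}(x-y)^{(n-j)}(x+n-\frac12)^{(j)}}{(x+\frac12)^{(j)}(y+j-\frac12)^{(j)}(y+2j+\frac12)^{(n-j)}}=0.$$
   Context: $(x)^{(n)}=x(x+1)\cdots(x+n-1)$ is the rising factorial (Pochhammer symbol), with $(x)^{(0)}=1$. *)

(* Defs.v *)
From mathcomp Require Import all_boot all_order all_algebra.
From mathcomp Require Import reals complex.

Set Implicit Arguments.
Unset Strict Implicit.
Unset Printing Implicit Defensive.

Import GRing.Theory.
Local Open Scope ring_scope.

Definition rising (A : pzSemiRingType) (z : A) (n : nat) : A :=
  \prod_(i < n) (z + i%:R).

(* Main.v *)
(* All eight identities are instances of three terminating hypergeometric
   summations. The first two are the Pfaff-Saalschutz sum, and the fifth and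
   sixth are the terminating Watson 3F2 sum (for even and odd length); both
   follow by induction on the length from recurrences certified in the
   Wilf-Zeilberger manner. The four vanishing sums are one very-well-poised 5F4
   sum with (p, q) = (a + b, 2b), (2b, a + b), (2y, x + y), (y + 1/2, x + 1/2);
   its partial sums have a closed form. *)
Require Import Defs.
From mathcomp Require Import all_boot all_order all_algebra.
From mathcomp Require Import reals complex.
From mathcomp Require Import zify ring.

Import Order.TTheory GRing.Theory Num.Theory.
Local Open Scope ring_scope.

(** * Rising factorials, telescoping and ratios of binomials *)

Lemma rising0 (A : pzSemiRingType) (z : A) : rising z 0 = 1.
Proof. by rewrite /rising big_ord0. Qed.

Lemma risingS (A : pzSemiRingType) (z : A) n :
  rising z n.+1 = rising z n * (z + n%:R).
Proof. by rewrite /rising big_ord_recr. Qed.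

Lemma rising_recl (A : pzSemiRingType) (z : A) n :
  rising z n.+1 = z * rising (z + 1) n.
Proof.
rewrite /rising big_ord_recl addr0; congr (_ * _).
by apply: eq_bigr => i _; rewrite -addrA nat1r.
Qed.

Lemma risingD (A : pzSemiRingType) (z : A) m n :
  rising z (m + n) = rising z m * rising (z + m%:R) n.
Proof.
elim: n => [|n IHn]; first by rewrite addn0 rising0 mulr1.
by rewrite addnS !risingS IHn natrD addrA mulrA.
Qed.

Lemma rising_neq0 (F : fieldType) (z : F) n :
  (forall k : nat, z + k%:R != 0) -> rising z n != 0.
Proof. by move=> z0; apply/prodf_neq0 => i _. Qed.

(** Telescoping in verification form: a conjectured closed form [g] of the partial sums is checked
    one step at a time. All certificates below enter through it; the bound [i < n] keeps lengths
    such as [n - i.+1] free of truncation. *)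
Lemma sum_partial (V : nmodType) (f g : nat -> V) n :
  f 0%N = g 0%N -> (forall i, (i < n)%N -> g i + f i.+1 = g i.+1) ->
  \sum_(i < n.+1) f i = g n.
Proof.
move=> fg0; elim: n => [|n IHn] fgS; first by rewrite big_ord1.
by rewrite big_ord_recr /= IHn ?fgS // => i lt_in; apply/fgS/ltnW.
Qed.

(** Writing the upper index as [i + k] avoids truncated subtraction. Such ratios reduce each
    telescoping step to an identity of rational functions. *)
Lemma natr_binSr (F : numFieldType) (i k : nat) :
  'C(i + k, i.+1)%:R = 'C(i + k, i)%:R * k%:R / i.+1%:R :> F.
Proof.
have i0 : i.+1%:R != 0 :> F by rewrite pnatr_eq0.
apply: (mulIf i0); rewrite divfK // -!natrM mulnC mul_bin_left addKn.
by rewrite mulnC.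
Qed.

Lemma natr_binSl (F : numFieldType) (i k : nat) :
  'C((i + k).+1, i)%:R = 'C(i + k, i)%:R * (i + k).+1%:R / k.+1%:R :> F.
Proof.
have k0 : k.+1%:R != 0 :> F by rewrite pnatr_eq0.
apply: (mulIf k0); rewrite divfK // -!natrM [in RHS]mulnC (mul_bin_down (i + k).+1).
by rewrite -addnS addKn mulnC.
Qed.

(** * The Pfaff-Saalschutz sum *)

Section Saalschutz.
Variables (F : numFieldType) (b c e : F).

(** The summand of 3F2(-n, c+e+n-1-b, b; c, e; 1), multiplied by [rising c n * rising e n] to clear
    denominators. *)
Definition saal_term n j : F :=
  (-1) ^+ j * 'C(n, j)%:R * rising (c + e + n%:R - 1 - b) j * rising b j
  * rising (c + j%:R) (n - j) * rising (e + j%:R) (n - j).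

(** Closed form, for i <= n, of the sum over j <= i of the combination in [saal_partial]. *)
Definition saal_cert n i : F :=
  (-1) ^+ i * (c + e + n%:R *+ 2 - b) * 'C(n, i)%:R
  * rising (c + e + n%:R - b) i * rising b i.+1
  * rising (c + i%:R) (n - i) * rising (e + i%:R) (n - i).

Lemma saal_partial n :
  \sum_(j < n.+1) (saal_term n.+1 j
                   - (c - b + n%:R) * (e - b + n%:R) * saal_term n j)
  = saal_cert n n.
Proof.
apply: (@sum_partial _ (fun j => saal_term n.+1 j
  - (c - b + n%:R) * (e - b + n%:R) * saal_term n j) (saal_cert n)).
  rewrite /saal_term /saal_cert !rising0 !subn0 !addr0 !bin0 !expr0 !risingS.
  by rewrite rising0; ring.
(* With n = i + k + 1 every length becomes an explicit successor. *)
move=> i /subnKC; move: (_ - _)%N => k <-; rewrite addSnnS.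
rewrite /saal_term /saal_cert binS [(binomial _ _ + _)%:R]natrD natr_binSr subSS !subnS !addKn /=.
have -> : c + e + (i + k.+1).+1%:R - 1 - b = c + e + (i + k.+1)%:R - b by ring.
have i0 : i.+1%:R != 0 :> F by rewrite pnatr_eq0.
have aE : rising (c + e + (i + k.+1)%:R - 1 - b) i.+1
  = (c + e + (i + k.+1)%:R - 1 - b) * rising (c + e + (i + k.+1)%:R - b) i.
  by rewrite rising_recl; congr (_ * rising _ _); ring.
have shift z : rising (z + i%:R) k.+1 = (z + i%:R) * rising (z + i.+1%:R) k.
  by rewrite rising_recl -addrA natr1.
rewrite aE !shift !risingS exprS.
(* Both sides now share the same binomial and rising factorials; treated as atoms, they leave a
   rational identity. *)
move: ((-1) ^+ i) ('C(_, _)%:R) (rising _ i) (rising b i) => sg u A B.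
move: (rising _ k) (rising _ k) => C E.
by field; rewrite nat1r.
Qed.

Lemma saalschutz n :
  \sum_(j < n.+1) saal_term n j = rising (c - b) n * rising (e - b) n.
Proof.
elim: n => [|n IHn].
  by rewrite big_ord1 /saal_term bin0 !rising0 !mulr1.
have := saal_partial n.
rewrite sumrB -mulr_sumr IHn => /(canRL (subrK _)) sumE.
(* The extra term j = n + 1 is the opposite of [saal_cert n n], so only the first-order recurrence
   in n survives. *)
rewrite big_ord_recr /= sumE.
rewrite /saal_term /saal_cert !subnn !binn !rising0 !risingS exprS.
have -> : c + e + n.+1%:R - 1 - b = c + e + n%:R - b by ring.
by ring.
Qed.

End Saalschutz.

(** * The terminating Watson sum *)

Section Watson.
Variables (F : numFieldType) (x y : F).

(** The summand of 3F2(-m, 2x+m-1, y; x, 2y; 1), multiplied by [rising x m * rising (2 * y) m]. *)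
Definition watson_term m j : F :=
  (-1) ^+ j * 'C(m, j)%:R * rising (x + j%:R) (m - j)
  * rising (2 * x + m%:R - 1) j * rising y j * rising (2 * y + j%:R) (m - j).

Definition watson_coef m : F :=
  m.+1%:R * (2 * x + m%:R - 2 * y) * (2 * y + m%:R)
  * (x + m%:R) * (x + m.+1%:R).

Definition watson_cert m i : F :=
  (-1) ^+ i * 2 * (2 * x + m%:R *+ 2 + 1) * (x + m.+1%:R) * 'C(m.+1, i)%:R
  * rising (2 * x + m%:R) i * rising y i.+1
  * rising (x + i%:R) (m.+1 - i) * rising (2 * y + i%:R) (m.+1 - i).

Hypothesis x_neq0 : forall k : nat, 2 * x + k%:R != 0.

(** Multiplied by [2 * x + m%:R], both sides become [rising (2 * x + m%:R) i.+2]. This denominator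
    is why the recurrence carries that factor on its left. *)
Let rising_shift m i :
  rising (2 * x + m.+2%:R - 1) i.+1
  = rising (2 * x + m%:R) i * (2 * x + m%:R + i%:R)
    * (2 * x + m%:R + i.+1%:R) / (2 * x + m%:R).
Proof.
apply: (canRL (mulfK (x_neq0 m))); rewrite mulrC -!risingS [in RHS]rising_recl.
by congr (_ * rising _ _); ring.
Qed.

Lemma watson_partial m :
  \sum_(j < m.+1) ((2 * x + m%:R) * watson_term m.+2 j
                   - watson_coef m * watson_term m j)
  = watson_cert m m.
Proof.
apply: (@sum_partial _ (fun j => (2 * x + m%:R) * watson_term m.+2 j
  - watson_coef m * watson_term m j) (watson_cert m)).
  rewrite /watson_term /watson_cert /watson_coef !rising0 !subn0 !addr0 !bin0.
  by rewrite !expr0 !risingS rising0; ring.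
move=> i /subnKC; move: (_ - _)%N => k; rewrite addSnnS => mE.
have [d0 d1 d2 d3] : [/\ m.+2 - i.+1 = k.+2, m - i.+1 = k,
    m.+1 - i = k.+2 & m.+1 - i.+1 = k.+1]%N by split; lia.
rewrite /watson_term /watson_cert /watson_coef d0 d1 d2 d3.
have b1 : 'C(m.+1, i.+1)%:R = 'C(m.+1, i)%:R * k.+2%:R / i.+1%:R :> F.
  by rewrite -mE -addnS natr_binSr.
have b2 : 'C(m, i.+1)%:R = 'C(m, i)%:R * k.+1%:R / i.+1%:R :> F.
  by rewrite -mE natr_binSr.
have b3 : 'C(m.+1, i)%:R = 'C(m, i)%:R * m.+1%:R / k.+2%:R :> F.
  by rewrite -mE natr_binSl.
rewrite binS natrD b1 b2 b3 rising_shift [rising (_ - 1) _]rising_recl.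
have -> : 2 * x + m%:R - 1 + 1 = 2 * x + m%:R by ring.
have shift (z : F) l :
    rising (z + i%:R) l.+1 = (z + i%:R) * rising (z + i.+1%:R) l.
  by rewrite rising_recl -addrA natr1.
rewrite !shift !risingS exprS.
have s0 := x_neq0 m.
have i0 : i.+1%:R != 0 :> F by rewrite pnatr_eq0.
have k0 : k.+2%:R != 0 :> F by rewrite pnatr_eq0.
move: ((-1) ^+ i) ('C(_, _)%:R) (rising _ i) (rising y i) => sg u A B.
move: (rising _ k) (rising _ k) => C E.
rewrite -mE natrD in s0 *.
by field; rewrite !nat1r i0 s0 -natrD k0.
Qed.

(** The terms j = m + 1 and j = m + 2 together cancel [watson_cert m m]. The recurrence advances m
    by two, so even and odd lengths are settled separately from m = 0 and m = 1. *)
Lemma watsonSS m :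
  (2 * x + m%:R) * (\sum_(j < m.+3) watson_term m.+2 j)
  = watson_coef m * \sum_(j < m.+1) watson_term m j.
Proof.
have := watson_partial m.
rewrite sumrB -!mulr_sumr => /(canRL (subrK _)) sumE.
rewrite big_ord_recr big_ord_recr /= !mulrDr sumE.
rewrite /watson_term /watson_cert !subnn !subSnn !binn !binSn !rising_shift.
rewrite !risingS !rising0 !exprS.
have s0 := x_neq0 m.
by field.
Qed.

Lemma watson_odd n : \sum_(j < (2 * n).+2) watson_term (2 * n).+1 j = 0.
Proof.
elim: n => [|n IHn].
  rewrite muln0 big_ord_recr big_ord1 /= /watson_term !rising0 !risingS !rising0.
  by rewrite bin0 bin1 /=; ring.
have /(congr1 (fun z => (2 * x + (2 * n).+1%:R)^-1 * z)) := watsonSS (2 * n).+1.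
by rewrite mulKf // IHn !mulr0 mulnS.
Qed.

Lemma watson_even n :
  \sum_(j < (2 * n).+1) watson_term (2 * n) j
  = (2 * n)`!%:R / n`!%:R * rising (x - y) n * rising y n * rising (x + n%:R) n.
Proof.
elim: n => [|n IHn].
  by rewrite muln0 big_ord1 /watson_term !rising0 bin0 divr1 !mulr1.
apply: (mulfI (x_neq0 (2 * n))); rewrite mulnS watsonSS IHn /watson_coef.
have n0 : n`!%:R != 0 :> F by rewrite pnatr_eq0 -lt0n fact_gt0.
(* The nonvanishing of 2x + 2n = 2(x + n) gives this. *)
have xn0 : x + n%:R != 0.
  have := x_neq0 (2 * n); rewrite natrM -mulrDr; apply: contra => /eqP ->.
  by rewrite mulr0.
have -> : rising (x + n.+1%:R) n.+1
    = rising (x + n%:R) n * (x + n%:R + n%:R) * (x + n%:R + n.+1%:R)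
      / (x + n%:R).
  apply: (canRL (mulfK xn0)); rewrite mulrC -!risingS [RHS]rising_recl.
  by rewrite -[x + n%:R + 1]addrA natr1.
rewrite !risingS [n.+1`!]factS !factS !natrM.
by field; rewrite nat1r xn0 n0 pnatr_eq0.
Qed.

End Watson.

(** * The vanishing very-well-poised sum *)

Section WellPoised.
Variables (F : numFieldType) (p q : F).
Hypotheses (p_neq0 : forall k : nat, p + k%:R != 0)
           (q_neq0 : forall k : nat, q + k%:R != 0).

(** Up to a factor free of j, the very-well-poised 5F4 summand with leading parameter p - 1 and
    further parameters p - q, q + n - 1, -n. Its factor p + 2j - 1 is already cancelled, so that p =
    1 causes no division by zero. *)
Definition wp_term n j : F :=
  'C(n, j)%:R * (rising (q - p) (n - j) * rising (p - q) j
                 * rising (q + n%:R - 1) j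
  / (rising q j * rising (p + j%:R - 1) j * rising (p + 2 * j%:R) (n - j))).

(** Closed form, for i <= n, of the partial sums of [wp_term n.+1], the last term j = n + 1 being
    left out. *)
Definition wp_partial n i : F :=
  'C(n, i)%:R * (rising (q + n.+1%:R) i * rising (p - q + 1) i
                 * rising (q - p) (n.+1 - i)
  / (rising q i * rising (p + i%:R) n.+1)).

Lemma sum_wp_term n : \sum_(j < n.+1) wp_term n.+1 j = wp_partial n n.
Proof.
apply: (@sum_partial _ (wp_term n.+1) (wp_partial n)).
  by rewrite /wp_term /wp_partial !rising0 !bin0 mulr0 !addr0 !mulr1 !mul1r.
move=> i /subnKC; move: (_ - _)%N => k; rewrite addSnnS => nE.
have [d0 d1] : (n.+1 - i.+1 = k.+1)%N /\ (n.+1 - i = k.+2)%N by lia.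
rewrite /wp_term /wp_partial d0 d1 binS natrD.
have -> : 'C(n, i.+1)%:R = 'C(n, i)%:R * k.+1%:R / i.+1%:R :> F.
  by rewrite -nE natr_binSr.
have -> : q + n.+1%:R - 1 = q + n%:R by ring.
have -> : rising (q + n%:R) i.+1 = (q + n%:R) * rising (q + n.+1%:R) i.
  by rewrite rising_recl -addrA natr1.
have -> : rising (p - q) i.+1 = (p - q) * rising (p - q + 1) i.
  exact: rising_recl.
have -> : p + i.+1%:R - 1 = p + i%:R by ring.
(* Both long products are split so that they share [rising (p + i%:R) i] and
   [rising (p + 2 * i.+1%:R) k] with the summand. *)
have -> : rising (p + i%:R) n.+1
    = rising (p + i%:R) i.+1 * (p + i%:R + i.+1%:R)
      * rising (p + 2 * i.+1%:R) k.
  rewrite -risingS.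
  have -> : n.+1 = (i.+2 + k)%N by lia.
  by rewrite risingD; congr (_ * rising _ _); ring.
have -> : rising (p + i.+1%:R) n.+1
    = rising (p + i%:R) i.+1 * (p + i%:R + i.+1%:R)
      * rising (p + 2 * i.+1%:R) k.+1 / (p + i%:R).
  apply: (canRL (mulfK (p_neq0 i))).
  have -> : p + i.+1%:R = p + i%:R + 1 by rewrite -addrA natr1.
  rewrite mulrC -rising_recl -risingS.
  have -> : n.+2 = (i.+2 + k.+1)%N by lia.
  by rewrite risingD; congr (_ * rising _ _); ring.
have q0 := rising_neq0 _ _ i q_neq0.
have A0 : rising (p + i%:R) i != 0.
  by apply: rising_neq0 => k'; rewrite -addrA -natrD.
have B0 : rising (p + 2 * i.+1%:R) k != 0.
  by apply: rising_neq0 => k'; rewrite -natrM -addrA -natrD.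
have qi0 := q_neq0 i.
have pi0 := p_neq0 i.
have a0 : p + i%:R + i%:R != 0 by rewrite -addrA -natrD.
have b0 : p + i%:R + i.+1%:R != 0 by rewrite -addrA -natrD.
have c0 : p + 2 * i.+1%:R + k%:R != 0 by rewrite -natrM -addrA -natrD.
have i0 : i.+1%:R != 0 :> F by rewrite pnatr_eq0.
rewrite !risingS -nE.
move: (rising q i) (rising (p + _) i) (rising (p + _) k) q0 A0 B0 => Q A B.
move: ('C(_, _)%:R) (rising _ i) (rising _ i) (rising _ k) => u X Y Z q0 A0 B0.
by field; rewrite !nat1r pi0 c0 B0 b0 a0 A0 qi0 q0 i0.
Qed.

Lemma well_poised n :
  (0 < n)%N -> \sum_(j < n.+1) wp_term n j = 0.
Proof.
(* The term j = n + 1 is the opposite of [wp_partial n n]. *)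
case: n => // n _; rewrite big_ord_recr /= sum_wp_term /wp_term /wp_partial.
rewrite !subnn subSnn !binn !rising0.
have -> : p + n.+1%:R - 1 = p + n%:R by ring.
have -> : q + n.+1%:R - 1 = q + n%:R by ring.
have -> : rising (q + n%:R) n.+1 = (q + n%:R) * rising (q + n.+1%:R) n.
  by rewrite rising_recl -addrA natr1.
rewrite [rising (p - q) _]rising_recl [rising q n.+1]risingS.
rewrite [rising _ 1]risingS rising0.
have qn0 := q_neq0 n.
have q0 := rising_neq0 _ _ n q_neq0.
have A0 : rising (p + n%:R) n.+1 != 0.
  by apply: rising_neq0 => k; rewrite -addrA -natrD.
by field; rewrite A0 qn0 q0.
Qed.

(** The factor p + 2j - 1 sits in the middle of [rising (p + j%:R - 1) n.+1] and cancels against the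
    numerator. The nonzero denominator licenses this, notably at j = 0, where the factor is p -
    1. *)
Lemma wp_termE n j : (j <= n)%N ->
  rising (p + j%:R - 1) n.+1 * rising q j != 0 ->
  'C(n, j)%:R * ((rising (q + n%:R - 1) j * rising (q - p) (n - j)
                  * rising (p - q) j * (p + 2 * j%:R - 1))
                 / (rising (p + j%:R - 1) n.+1 * rising q j))
  = wp_term n j.
Proof.
move=> le_jn; rewrite /wp_term.
have -> : rising (p + j%:R - 1) n.+1
    = rising (p + j%:R - 1) j * (p + 2 * j%:R - 1)
      * rising (p + 2 * j%:R) (n - j).
  have -> : p + 2 * j%:R - 1 = p + j%:R - 1 + j%:R by ring.
  rewrite -risingS -{1}(subnKC le_jn) -addSn risingD.
  by congr (_ * rising _ _); ring.
rewrite !mulf_eq0 !negb_or => /andP[/andP[/andP[A0 t0] B0] q0].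
by field; rewrite q0 B0 t0 A0.
Qed.

End WellPoised.

(** * Specialization to complex parameters with positive real part *)

Lemma complex_Re_gt0_neq0 (R : realType) (z : R[i]%C) (k : nat) :
  0 < complex.Re z -> z + k%:R != 0.
Proof.
move=> z0; apply: contraTneq z0 => /eqP; rewrite addr_eq0 => /eqP ->.
by rewrite -(rmorph_nat (real_complex R)) /= oppr_gt0 -leNgt ler0n.
Qed.

Local Open Scope complex_scope.

Theorem corollary1 (R : realType) (n : nat) (x y a b : R[i])
  (hn : (0 < n)%N)
  (hx : 0 < complex.Re x) (hy : 0 < complex.Re y)
  (ha : 0 < complex.Re a) (hb : 0 < complex.Re b) :
  (\sum_(j < n.+1) (-1) ^+ (n - j) * 'C(n, j)%:R
      * rising (x + y + n%:R - 1) (n - j) * rising (x + n%:R - j%:R) j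
      * rising (2 * y + n%:R - j%:R) j * rising y (n - j)
    = rising (x - y) n * rising y n)
  /\
  (\sum_(j < n.+1) (-1) ^+ j * 'C(n, j)%:R
      * rising (2 * y + n%:R - 1) j * rising (y + j%:R) (n - j)
      * rising x j * rising (x + y + j%:R) (n - j)
    = rising (y - x) n * rising y n)
  /\
  ((forall j : 'I_n.+1,
      rising (a + b + j%:R - 1) n.+1 * rising (2 * b) j != 0) ->
   \sum_(j < n.+1) 'C(n, j)%:R
      * ((rising (2 * b + n%:R - 1) j * rising (b - a) (n - j)
            * rising (a - b) j * (a + b + 2 * j%:R - 1))
         / (rising (a + b + j%:R - 1) n.+1 * rising (2 * b) j))
    = 0)
  /\
  ((forall j : 'I_n.+1,
      rising (2 * b + j%:R - 1) n.+1 * rising (a + b) j != 0) ->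
   \sum_(j < n.+1) 'C(n, j)%:R
      * ((rising (a + b + n%:R - 1) j * rising (a - b) (n - j)
            * rising (b - a) j * (2 * b + 2 * j%:R - 1))
         / (rising (2 * b + j%:R - 1) n.+1 * rising (a + b) j))
    = 0)
  /\
  (\sum_(j < (2 * n).+1) (-1) ^+ j * 'C(2 * n, j)%:R
      * rising (x + j%:R) (2 * n - j) * rising (2 * x + 2 * n%:R - 1) j
      * rising y j * rising (2 * y + j%:R) (2 * n - j)
    = (2 * n)`!%:R / n`!%:R
      * rising (x - y) n * rising y n * rising (x + n%:R) n)
  /\
  (\sum_(j < (2 * n + 1).+1) (-1) ^+ j * 'C(2 * n + 1, j)%:R
      * rising (2 * x + 2 * n%:R) j * rising (x + j%:R) (2 * n + 1 - j)
      * rising y j * rising (2 * y + j%:R) (2 * n + 1 - j)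
    = 0)
  /\
  ((forall j : 'I_n.+1,
      rising (x + y) j * rising (2 * y + j%:R - 1) j
        * rising (2 * y + 2 * j%:R) (n - j) != 0) ->
   \sum_(j < n.+1) 'C(n, j)%:R
      * ((rising (x - y) (n - j) * rising (y - x) j
            * rising (x + y + n%:R - 1) j)
         / (rising (x + y) j * rising (2 * y + j%:R - 1) j
              * rising (2 * y + 2 * j%:R) (n - j)))
    = 0)
  /\
  ((forall j : 'I_n.+1,
      rising (x + 2^-1) j * rising (y + j%:R - 2^-1) j
        * rising (y + 2 * j%:R + 2^-1) (n - j) != 0) ->
   \sum_(j < n.+1) 'C(n, j)%:R
      * ((rising (y - x) j * rising (x - y) (n - j)
            * rising (x + n%:R - 2^-1) j)
         / (rising (x + 2^-1) j * rising (y + j%:R - 2^-1) j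
              * rising (y + 2 * j%:R + 2^-1) (n - j)))
    = 0).

Proof.
split.
  (* Here b = y, c = x, e = 2y, and the sum is read backwards, j becoming n - j. *)
  have := @saalschutz _ y x (2 * y) n.
  have -> : 2 * y - y = y by ring.
  move=> <-; rewrite (reindex_inj rev_ord_inj) /=.
  apply: eq_bigr => j _; have le_jn := leq_ord j.
  rewrite subSS subKn // bin_sub // natrB // /saal_term.
  have -> : x + 2 * y + n%:R - 1 - y = x + y + n%:R - 1 by ring.
  have subE (z : R[i]) : z + n%:R - (n%:R - j%:R) = z + j%:R by ring.
  by rewrite !subE; ring.
split.
  have := @saalschutz _ x y (x + y) n.
  rewrite [x + y - x]addrC addKr => <-.
  apply: eq_bigr => j _; rewrite /saal_term.
  have -> : y + (x + y) + n%:R - 1 - x = 2 * y + n%:R - 1 by ring.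
  by ring.
(* Positive real parts supply the nonvanishing hypotheses of the Watson and well-poised sums. *)
have ReD (u v : R[i]) : 0 < complex.Re u -> 0 < complex.Re v ->
  forall k : nat, u + v + k%:R != 0.
  move=> u0 v0 k; apply: complex_Re_gt0_neq0.
  by rewrite raddfD addr_gt0.
have Re2 (u : R[i]) : 0 < complex.Re u -> forall k : nat, 2 * u + k%:R != 0.
  by move=> u0 k; rewrite mulr_natl mulr2n ReD.
split.
  move=> nz; rewrite -[RHS](@well_poised _ _ _ (ReD _ _ ha hb) (Re2 _ hb) n hn).
  apply: eq_bigr => j _; have := nz j; have := leq_ord j.
  move=> le_jn /(wp_termE _ _ _ _ _ le_jn) <-.
  have -> : 2 * b - (a + b) = b - a by ring.
  by have -> : a + b - 2 * b = a - b by ring.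
split.
  move=> nz; rewrite -[RHS](@well_poised _ _ _ (Re2 _ hb) (ReD _ _ ha hb) n hn).
  apply: eq_bigr => j _; have := nz j; have := leq_ord j.
  move=> le_jn /(wp_termE _ _ _ _ _ le_jn) <-.
  have -> : 2 * b - (a + b) = b - a by ring.
  by have -> : a + b - 2 * b = a - b by ring.
split.
  rewrite -(@watson_even _ _ y (Re2 _ hx)).
  by apply: eq_bigr => j _; rewrite /watson_term natrM; ring.
split.
  rewrite addn1 -[RHS](@watson_odd _ _ y (Re2 _ hx) n).
  apply: eq_bigr => j _; rewrite /watson_term.
  have -> : 2 * x + (2 * n).+1%:R - 1 = 2 * x + 2 * n%:R by ring.
  by ring.
split.
  move=> _; rewrite -[RHS](@well_poised _ _ _ (Re2 _ hy) (ReD _ _ hx hy) n hn).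
  apply: eq_bigr => j _; rewrite /wp_term.
  have -> : x + y - 2 * y = x - y by ring.
  by have -> : 2 * y - (x + y) = y - x by ring.
(* Lets [ReD] apply to p = y + 1/2 and q = x + 1/2. *)
have half0 : 0 < complex.Re (2^-1 : R[i]).
  have -> : 2^-1 = (2^-1)%:C :> R[i] by rewrite fmorphV rmorph_nat.
  by rewrite /= invr_gt0 ltr0n.
move=> _.
rewrite -[RHS](@well_poised _ _ _ (ReD _ _ hy half0) (ReD _ _ hx half0) n hn).
apply: eq_bigr => j _; rewrite /wp_term.
have -> : x + 2^-1 - (y + 2^-1) = x - y by ring.
have -> : y + 2^-1 - (x + 2^-1) = y - x by ring.
have halfE (z : R[i]) k : z + 2^-1 + k%:R - 1 = z + k%:R - 2^-1 by field.
by rewrite !halfE [y + 2^-1 + _]addrAC [_ * rising (x - y) _]mulrC.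
Qed.
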